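(* Let $n=2m$ or $n=2m+1$, and let $U,\tilde U,Q\in\mathbb{R}^{n\times n}$ and the discrete cosine and sine transform matrices $\mathscr C^{\rm I},\mathscr C^{\rm II},\mathscr C^{\rm V},\mathscr C^{\rm VI},\mathscr S^{\rm I},\mathscr S^{\rm II},\mathscr S^{\rm V},\mathscr S^{\rm VI}$ be as defined in the context. Then $$QU=\begin{cases}\begin{bmatrix}\mathscr C_{m+1}^{\rm I}&0\\0&J_{m-1}\mathscr S_{m-1}^{\rm I}J_{m-1}\end{bmatrix},& n=2m,\\[4mm]\begin{bmatrix}\mathscr C_{m+1}^{\rm V}&0\\0&J_m\mathscr S_m^{\rm V}J_m\end{bmatrix},& n=2m+1,\end{cases}$$ and $$Q^T\tilde U=\begin{cases}\begin{bmatrix}\mathscr C_{m}^{\rm II}&0\\0&J_m\mathscr S_{m}^{\rm II}J_m\end{bmatrix},& n=2m,\\[4mm]\begin{bmatrix}\mathscr C_{m+1}^{\rm VI}&0\\0&J_m\mathscr S_{m}^{\rm VI}J_m\end{bmatrix},& n=2m+1.\end{cases}$$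
   Context: $I_k$ is the identity matrix of order $k$ and $J_k$ is the permutation matrix of order $k$ with ones on the anti-diagonal (bottom left to top right) and zeros elsewhere. Blocks of size $0$ are understood to be absent. Let $\omega=\exp(2\pi i/n)$, $F=\left(\frac{1}{\sqrt n}\omega^{-jk}\right)_{j,k=0}^{n-1}$, $D=\mathrm{diag}(1,e^{\pi i/n},\dots,e^{(n-1)\pi i/n})$ and $\tilde F=DF^*$. Write $F=[\boldsymbol f_0,\dots,\boldsymbol f_{n-1}]$ and $\tilde F=[\tilde{\boldsymbol f}_0,\dots,\tilde{\boldsymbol f}_{n-1}]$ by columns, and split into real and imaginary parts $\boldsymbol f_k=\hat{\boldsymbol c}_k+i\hat{\boldsymbol s}_k$, $\tilde{\boldsymbol f}_k=\tilde{\boldsymbol c}_k+i\tilde{\boldsymbol s}_k$ with real vectors $\hat{\boldsymbol c}_k,\hat{\boldsymbol s}_k,\tilde{\boldsymbol c}_k,\tilde{\boldsymbol s}_k\in\mathbb{R}^n$. Definition of $U$ (by columns): - $n=2m$: $U=[\hat{\boldsymbol c}_0,\sqrt2\,\hat{\boldsymbol c}_1,\dots,\sqrt2\,\hat{\boldsymbol c}_{m-1},\hat{\boldsymbol c}_m,\sqrt2\,\hat{\boldsymbol s}_{m-1},\dots,\sqrt2\,\hat{\boldsymbol s}_1]$; - $n=2m+1$: $U=[\hat{\boldsymbol c}_0,\sqrt2\,\hat{\boldsymbol c}_1,\dots,\sqrt2\,\hat{\boldsymbol c}_m,\sqrt2\,\hat{\boldsymbol s}_m,\dots,\sqrt2\,\hat{\boldsymbol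 s}_1]$. Definition of $\tilde U$ (by columns): - $n=2m$: $\tilde U=[\sqrt2\,\tilde{\boldsymbol c}_0,\dots,\sqrt2\,\tilde{\boldsymbol c}_{m-1},\sqrt2\,\tilde{\boldsymbol s}_{m-1},\dots,\sqrt2\,\tilde{\boldsymbol s}_0]$; - $n=2m+1$: $\tilde U=[\sqrt2\,\tilde{\boldsymbol c}_0,\dots,\sqrt2\,\tilde{\boldsymbol c}_{m-1},\tilde{\boldsymbol c}_m,\sqrt2\,\tilde{\boldsymbol s}_{m-1},\dots,\sqrt2\,\tilde{\boldsymbol s}_0]$. Definition of $Q$: $$Q=\frac1{\sqrt2}\begin{bmatrix}\sqrt2&0&0&0\\0&I_{m-1}&0&J_{m-1}\\0&0&\sqrt2&0\\0&-J_{m-1}&0&I_{m-1}\end{bmatrix}\ (n=2m),\qquad Q=\frac1{\sqrt2}\begin{bmatrix}\sqrt2&0&0\\0&I_m&J_m\\0&-J_m&I_m\end{bmatrix}\ (n=2m+1).$$ Transform matrices. For a positive integer $N$ put $\tau_l=\frac1{\sqrt2}$ if $l=0$ or $l=N$ and $\tau_l=1$ otherwise; and $\iota_k=\frac{1}{\sqrt2}$ if $k=N-1$ and $\iota_k=1$ otherwise. Then $$\mathscr C_{N+1}^{\rm I}=\sqrt{\tfrac2N}\left[\tau_j\tau_k\cos\tfrac{jk\pi}{N}\right]_{j,k=0}^{N},\qquad \mathscr C_N^{\rm II}=\sqrt{\tfrac2N}\left[\tau_j\cos\tfrac{j(2k+1)\pi}{2N}\right]_{j,k=0}^{N-1},$$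 $$\mathscr C_N^{\rm V}=\tfrac{2}{\sqrt{2N-1}}\left[\tau_j\tau_k\cos\tfrac{2jk\pi}{2N-1}\right]_{j,k=0}^{N-1},\qquad \mathscr C_N^{\rm VI}=\tfrac{2}{\sqrt{2N-1}}\left[\tau_j\iota_k\cos\tfrac{j(2k+1)\pi}{2N-1}\right]_{j,k=0}^{N-1},$$ $$\mathscr S_{N-1}^{\rm I}=\sqrt{\tfrac2N}\left[\sin\tfrac{jk\pi}{N}\right]_{j,k=1}^{N-1},\qquad \mathscr S_N^{\rm II}=\sqrt{\tfrac2N}\left[\tau_j\sin\tfrac{j(2k-1)\pi}{2N}\right]_{j,k=1}^{N},$$ $$\mathscr S_{N-1}^{\rm V}=\tfrac{2}{\sqrt{2N-1}}\left[\sin\tfrac{2jk\pi}{2N-1}\right]_{j,k=1}^{N-1},\qquad \mathscr S_{N-1}^{\rm VI}=\tfrac{2}{\sqrt{2N-1}}\left[\sin\tfrac{j(2k-1)\pi}{2N-1}\right]_{j,k=1}^{N-1}.$$ *)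

(* Defs.v *)
From HB Require Import structures.
From mathcomp Require Import all_boot all_order all_algebra.
From mathcomp Require Import complex.
From mathcomp Require Import boolp classical_sets reals topology normedtype.
From mathcomp Require Import sequences exp trigo.

Set Implicit Arguments.
Unset Strict Implicit.
Unset Printing Implicit Defensive.

Import Order.TTheory GRing.Theory Num.Theory.

Local Open Scope ring_scope.
Local Open Scope complex_scope.

(* All rows and columns are numbered from 0, as ordinals are.  In the sine
   transforms the mathematical indices start at 1, hence the shifts j.+1, k.+1. *)

Section Definitions.
Variable R : realType.

Definition antidiag_mx (k : nat) : 'M[R]_k :=
  \matrix_(i, j) (j == rev_ord i)%:R.

Section Fourier.
Variable n : nat.

Definition cexp (z : R[i]) : R[i] :=
  (expR (complex.Re z))%:C * (cos (complex.Im z) +i* sin (complex.Im z)).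

Definition omega : R[i] := cexp (0 +i* (2 * pi / n%:R)).

Definition Fmx : 'M[R[i]]_n :=
  \matrix_(j, k) (((Num.sqrt n%:R)^-1)%:C * omega ^- (j * k)).

Definition Dmx : 'M[R[i]]_n :=
  diag_mx (\row_k cexp (0 +i* (k%:R * pi / n%:R))).

Definition Ftmx : 'M[R[i]]_n := Dmx *m (map_mx conjc Fmx)^T.

(* Column number k of A, for k a natural number; it is 0 when k >= n, a case
   that does not occur in the definitions of U and Ut below. *)
Definition ncol (T : nmodType) (A : 'M[T]_n) (k : nat) : 'cV[T]_n :=
  oapp (fun i => col i A) 0 (insub k).

Definition chat (k : nat) : 'cV[R]_n := map_mx (@complex.Re R) (ncol Fmx k).
Definition shat (k : nat) : 'cV[R]_n := map_mx (@complex.Im R) (ncol Fmx k).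
Definition ctilde (k : nat) : 'cV[R]_n := map_mx (@complex.Re R) (ncol Ftmx k).
Definition stilde (k : nat) : 'cV[R]_n := map_mx (@complex.Im R) (ncol Ftmx k).

Definition mx_of_cols (s : seq 'cV[R]_n) : 'M[R]_n :=
  \matrix_(i, j) (nth 0 s j) i 0.

End Fourier.

Local Notation sqrt2 := (Num.sqrt 2 : R).

Definition U_even_cols (m : nat) : seq 'cV[R]_(2 * m) :=
  chat (2 * m) 0 :: [seq sqrt2 *: chat (2 * m) k | k <- iota 1 m.-1]
  ++ chat (2 * m) m :: rev [seq sqrt2 *: shat (2 * m) k | k <- iota 1 m.-1].

Definition U_odd_cols (m : nat) : seq 'cV[R]_((2 * m).+1) :=
  chat (2 * m).+1 0 :: [seq sqrt2 *: chat (2 * m).+1 k | k <- iota 1 m]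
  ++ rev [seq sqrt2 *: shat (2 * m).+1 k | k <- iota 1 m].

Definition Ut_even_cols (m : nat) : seq 'cV[R]_(2 * m) :=
  [seq sqrt2 *: ctilde (2 * m) k | k <- iota 0 m]
  ++ rev [seq sqrt2 *: stilde (2 * m) k | k <- iota 0 m].

Definition Ut_odd_cols (m : nat) : seq 'cV[R]_((2 * m).+1) :=
  [seq sqrt2 *: ctilde (2 * m).+1 k | k <- iota 0 m]
  ++ ctilde (2 * m).+1 m
  :: rev [seq sqrt2 *: stilde (2 * m).+1 k | k <- iota 0 m].

Definition U_even (m : nat) : 'M[R]_(2 * m) := mx_of_cols (U_even_cols m).
Definition U_odd (m : nat) : 'M[R]_((2 * m).+1) := mx_of_cols (U_odd_cols m).
Definition Ut_even (m : nat) : 'M[R]_(2 * m) := mx_of_cols (Ut_even_cols m).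
Definition Ut_odd (m : nat) : 'M[R]_((2 * m).+1) := mx_of_cols (Ut_odd_cols m).

Lemma size_U_even_cols m : (0 < m)%N -> size (U_even_cols m) = (2 * m)%N.
Proof.
case: m => // m _; rewrite /= size_cat /= size_rev !size_map size_iota.
by rewrite mul2n -addnn addSn.
Qed.

Lemma size_U_odd_cols m : size (U_odd_cols m) = (2 * m).+1.
Proof.
by rewrite /= size_cat size_rev !size_map size_iota mul2n -addnn.
Qed.

Lemma size_Ut_even_cols m : size (Ut_even_cols m) = (2 * m)%N.
Proof.
by rewrite size_cat size_rev !size_map size_iota mul2n -addnn.
Qed.

Lemma size_Ut_odd_cols m : size (Ut_odd_cols m) = (2 * m).+1.
Proof.
by rewrite size_cat /= size_rev !size_map size_iota mul2n -addnn addnS.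
Qed.

Lemma dim_Q_even m : (0 < m)%N -> (1 + m.-1 + (1 + m.-1) = 2 * m)%N.
Proof. by move=> m_gt0; rewrite add1n prednK // addnn mul2n. Qed.

Lemma dim_QU_even m : (0 < m)%N -> (m.+1 + m.-1 = 2 * m)%N.
Proof. by move=> m_gt0; rewrite addSnnS prednK // addnn mul2n. Qed.

Lemma dim_QtUt_even m : (m + m = 2 * m)%N.
Proof. by rewrite addnn mul2n. Qed.

Lemma dim_Q_odd m : (1 + (m + m) = (2 * m).+1)%N.
Proof. by rewrite addnn mul2n. Qed.

Lemma dim_odd m : (m.+1 + m = (2 * m).+1)%N.
Proof. by rewrite addSn addnn mul2n. Qed.

(* The 4 x 4 block matrix, with its rows and its columns of blocks grouped
   two by two. *)
Definition Q_even (m : nat) (m_gt0 : (0 < m)%N) : 'M[R]_(2 * m) :=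
  let I := 1%:M : 'M[R]_m.-1 in
  let J := antidiag_mx m.-1 in
  let r : 'M[R]_1 := sqrt2%:M in
  sqrt2^-1 *: castmx (dim_Q_even m_gt0, dim_Q_even m_gt0)
    (block_mx (block_mx r 0 0 I)  (block_mx 0 0 0 J)
              (block_mx 0 0 0 (- J)) (block_mx r 0 0 I)).

Definition Q_odd (m : nat) : 'M[R]_((2 * m).+1) :=
  let I := 1%:M : 'M[R]_m in
  let J := antidiag_mx m in
  let r : 'M[R]_1 := sqrt2%:M in
  sqrt2^-1 *: castmx (dim_Q_odd m, dim_Q_odd m)
    (block_mx r 0
              0 (block_mx I J
                          (- J) I)).

Definition tau (N l : nat) : R :=
  if (l == 0)%N || (l == N) then sqrt2^-1 else 1.

Definition iot (N k : nat) : R := if k == N.-1 then sqrt2^-1 else 1.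

(* The argument N is the one of the usual formulas, not always the order of
   the matrix. *)
Definition DCT1 (N : nat) : 'M[R]_N.+1 :=
  Num.sqrt (2 / N%:R) *:
    \matrix_(j, k) (tau N j * tau N k * cos ((j * k)%:R * pi / N%:R)).

Definition DCT2 (N : nat) : 'M[R]_N :=
  Num.sqrt (2 / N%:R) *:
    \matrix_(j, k) (tau N j * cos (j%:R * (2 * k%:R + 1) * pi / (2 * N%:R))).

Definition DCT5 (N : nat) : 'M[R]_N :=
  (2 / Num.sqrt (2 * N%:R - 1)) *:
    \matrix_(j, k)
      (tau N j * tau N k * cos (2 * (j * k)%:R * pi / (2 * N%:R - 1))).

Definition DCT6 (N : nat) : 'M[R]_N :=
  (2 / Num.sqrt (2 * N%:R - 1)) *:
    \matrix_(j, k)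
      (tau N j * iot N k
       * cos (j%:R * (2 * k%:R + 1) * pi / (2 * N%:R - 1))).

Definition DST1 (N : nat) : 'M[R]_N.-1 :=
  Num.sqrt (2 / N%:R) *:
    \matrix_(j, k) sin ((j.+1 * k.+1)%:R * pi / N%:R).

Definition DST2 (N : nat) : 'M[R]_N :=
  Num.sqrt (2 / N%:R) *:
    \matrix_(j, k)
      (tau N j.+1
       * sin (j.+1%:R * (2 * k.+1%:R - 1) * pi / (2 * N%:R))).

Definition DST5 (N : nat) : 'M[R]_N.-1 :=
  (2 / Num.sqrt (2 * N%:R - 1)) *:
    \matrix_(j, k) sin (2 * (j.+1 * k.+1)%:R * pi / (2 * N%:R - 1)).

Definition DST6 (N : nat) : 'M[R]_N.-1 :=
  (2 / Num.sqrt (2 * N%:R - 1)) *: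
    \matrix_(j, k)
      sin (j.+1%:R * (2 * k.+1%:R - 1) * pi / (2 * N%:R - 1)).

End Definitions.

(* Main.v *)
(** With [n = 2 m] or [n = 2 m + 1], the matrix [Q] combines the rows [i] and
    [n - i] only, with the rows [i = 0] and [i = n / 2] left alone: it maps
    [(x, y)] to [(x + y, y - x) / sqrt 2], and [Q^T] is the same map with the
    opposite sign.  The columns of [U] and [Ut] are sampled cosines and sines,
    and each one is even or odd under [i -> n - i], because
    [cos (k pi - x) = (-1)^k cos x] and [sin (k pi - x) = - (-1)^k sin x].  So
    every butterfly either cancels a pair or doubles it, and what survives is
    the entry of the claimed cosine or sine transform. *)

Require Import Defs.
From HB Require Import structures.
From mathcomp Require Import all_boot all_order all_algebra.
From mathcomp Require Import complex.
From mathcomp Require Import reals exp trigo.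
From mathcomp Require Import zify ring lra.

Set Implicit Arguments.
Unset Strict Implicit.
Unset Printing Implicit Defensive.

Import Order.TTheory GRing.Theory Num.Theory.

Local Open Scope ring_scope.

(** * Reflections of cosine and sine, and the complex exponential on the imaginary axis *)

Section Trigonometry.
Variable R : realType.
Implicit Types (x y t : R) (k n : nat).

Lemma cos_npiB k x : cos (k%:R * pi - x) = (-1) ^+ k * cos x.
Proof.
elim: k => [|k IHk]; first by rewrite mul0r sub0r cosN mul1r.
rewrite -natr1 mulrDl mul1r addrAC cosDpi IHk exprS; ring.
Qed.

Lemma sin_npiB k x : sin (k%:R * pi - x) = - ((-1) ^+ k * sin x).
Proof.
elim: k => [|k IHk]; first by rewrite mul0r sub0r sinN mul1r.
rewrite -natr1 mulrDl mul1r addrAC sinDpi IHk exprS; ring.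
Qed.

Lemma cexpE t : cexp (0 +i* t)%C = (cos t +i* sin t)%C.
Proof. by rewrite /cexp /= expR0 mul1r. Qed.

Lemma cexpM x y : cexp (0 +i* x)%C * cexp (0 +i* y)%C = cexp (0 +i* (x + y))%C.
Proof.
rewrite !cexpE cosD sinD; apply/eqP; rewrite eq_complex /=.
by rewrite eqxx /= addrC.
Qed.

Lemma cexpX t k : cexp (0 +i* t)%C ^+ k = cexp (0 +i* (k%:R * t))%C.
Proof.
elim: k => [|k IHk]; first by rewrite expr0 mul0r cexpE cos0 sin0.
by rewrite exprS IHk cexpM -nat1r mulrDl mul1r.
Qed.

Lemma cexpV t : (cexp (0 +i* t)%C)^-1 = cexp (0 +i* - t)%C.
Proof.
have h : cexp (0 +i* t)%C * cexp (0 +i* - t)%C = 1.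
  by rewrite cexpM subrr cexpE cos0 sin0.
have u : cexp (0 +i* t)%C \is a GRing.unit.
  by apply/unitrPr; exists (cexp (0 +i* - t)%C).
by rewrite -[RHS](mulKr u) h mulr1.
Qed.

End Trigonometry.

(** * Entries of the two Fourier matrices and of their real and imaginary parts *)

Section FourierColumns.
Variable R : realType.

Definition dft_angle n j k : R := (2 * j * k)%:R * pi / n%:R.
(** The diagonal factor [Dmx] adds [j pi / n] to the angle [2 j k pi / n], hence the odd factor
    [2 k + 1]. *)
Definition shifted_angle n j k : R := (j * (2 * k).+1)%:R * pi / n%:R.

Lemma FmxE n (j k : 'I_n) :
  Fmx R n j k = ((Num.sqrt n%:R)^-1)%:C%C * cexp (0 +i* - dft_angle n j k)%C.
Proof.
rewrite mxE /omega cexpX cexpV; congr (_ * cexp (0 +i* - _)%C).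
rewrite /dft_angle -mulnA mulnC !natrM; ring.
Qed.

Lemma FtmxE n (j k : 'I_n) :
  Ftmx R n j k = ((Num.sqrt n%:R)^-1)%:C%C * cexp (0 +i* shifted_angle n j k)%C.
Proof.
rewrite /Ftmx /Dmx mul_diag_mx mxE [X in X * _]mxE.
rewrite [X in _ * X]mxE [X in _ * X]mxE FmxE.
have conj_cexp (a t : R) :
    conjc (a%:C * cexp (0 +i* t))%C = (a%:C * cexp (0 +i* - t))%C.
  rewrite !cexpE cosN sinN; apply/eqP; rewrite eq_complex /=.
  by rewrite !mul0r !subr0 !addr0 mulrN !eqxx.
rewrite conj_cexp opprK.
rewrite mulrCA cexpM; congr (_ * cexp (0 +i* _)%C).
by rewrite /dft_angle /shifted_angle; ring.
Qed.

Lemma ncol_ord (T : nmodType) n (A : 'M[T]_n) (k : 'I_n) : ncol A k = col k A.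
Proof. by rewrite /ncol valK. Qed.

Lemma chatE n k (i : 'I_n) : (k < n)%N ->
  chat R n k i 0 = (Num.sqrt n%:R)^-1 * cos (dft_angle n i k).
Proof.
move=> kn; rewrite mxE -[k]/(val (Ordinal kn)) ncol_ord mxE FmxE cexpE /=.
by rewrite mul0r subr0 cosN.
Qed.

Lemma shatE n k (i : 'I_n) : (k < n)%N ->
  shat R n k i 0 = - ((Num.sqrt n%:R)^-1 * sin (dft_angle n i k)).
Proof.
move=> kn; rewrite mxE -[k]/(val (Ordinal kn)) ncol_ord mxE FmxE cexpE /=.
by rewrite mul0r addr0 sinN mulrN.
Qed.

Lemma ctildeE n k (i : 'I_n) : (k < n)%N ->
  ctilde R n k i 0 = (Num.sqrt n%:R)^-1 * cos (shifted_angle n i k).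
Proof.
move=> kn; rewrite mxE -[k]/(val (Ordinal kn)) ncol_ord mxE FtmxE cexpE /=.
by rewrite mul0r subr0.
Qed.

Lemma stildeE n k (i : 'I_n) : (k < n)%N ->
  stilde R n k i 0 = (Num.sqrt n%:R)^-1 * sin (shifted_angle n i k).
Proof.
move=> kn; rewrite mxE -[k]/(val (Ordinal kn)) ncol_ord mxE FtmxE cexpE /=.
by rewrite mul0r addr0.
Qed.

End FourierColumns.

(** * The pairing of rows [i] and [n - i] performed by [Q] and its transpose *)

Section Butterfly.
Variable R : realType.
Implicit Types (e : R) (n i j l : nat) (f : nat -> R).

Local Notation sqrt2 := (Num.sqrt 2 : R).

Definition self_paired n i := ((i == 0) || (2 * i == n))%N.

(** For [n = 2 N] these are the weights [tau N]; for odd [n] only [i = 0] gets the smaller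
    weight. *)
Definition halved n i : R := if self_paired n i then sqrt2^-1 else 1.

(* The entries of [Q] for [e = 1] and of [Q^T] for [e = -1]. *)
Definition butterfly e n i l : R :=
  if i == l then (if self_paired n i then 1 else sqrt2^-1)
  else if (i + l == n)%N then
    (if (i < l)%N then e * sqrt2^-1 else - (e * sqrt2^-1))
  else 0.

Definition pair_sign e n i : R := if (2 * i < n)%N then e else - e.

(** Transposition exchanges which of two paired indices is the smaller, and so flips the
    off-diagonal sign. *)
Lemma butterflyC e n i l : butterfly e n l i = butterfly (- e) n i l.
Proof.
rewrite /butterfly [l == i]eq_sym [(l + i)%N]addnC.
case: eqVneq => [-> //|neq_il]; case: eqP => // _.
by case: ltngtP neq_il => // _ _; rewrite !mulNr ?opprK.
Qed.

Lemma sqrt2_neq0 : sqrt2 != 0.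
Proof. by rewrite sqrtr_eq0 -ltNge ltr0n. Qed.

Lemma sqrt2_sqr : sqrt2 * sqrt2 = 2.
Proof. by rewrite -expr2 sqr_sqrtr. Qed.

Lemma sqrt2V : sqrt2^-1 = sqrt2 / 2.
Proof.
apply: (mulfI sqrt2_neq0).
by rewrite mulrA sqrt2_sqr !mulfV ?sqrt2_neq0 ?pnatr_eq0.
Qed.

Lemma sum_butterfly e n f i : (i < n)%N ->
  \sum_(l < n) butterfly e n i l * f l =
    if self_paired n i then f i
    else sqrt2^-1 * (f i + pair_sign e n i * f (n - i)%N).
Proof.
move=> lt_in; rewrite (bigD1 (Ordinal lt_in)) //= /butterfly eqxx.
case: ifPn => [|npair_i].
  rewrite /self_paired => pair_i; rewrite mul1r big1 ?addr0 // => l.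
  rewrite -val_eqE /= => neq_li; rewrite eq_sym (negbTE neq_li).
  (* A second nonzero entry would sit at [l = n - i]: this is [n], out of range, when [i = 0], and
     [i] itself when [2 * i = n]. *)
  by rewrite ifF ?mul0r //; have := ltn_ord l; lia.
have lt_nin : (n - i < n)%N by move: npair_i; rewrite /self_paired; lia.
rewrite (bigD1 (Ordinal lt_nin)) /=; last first.
  by move: npair_i; rewrite -val_eqE /self_paired /=; lia.
rewrite big1 => [|l]; last first.
  rewrite -!val_eqE /= => /andP [neq_li neq_lni].
  by rewrite eq_sym (negbTE neq_li) ifF ?mul0r //; lia.
rewrite ifF; last by move: npair_i; rewrite /self_paired; lia.
rewrite subnKC ?(ltnW lt_in) // eqxx addr0 mulrDr /pair_sign.
congr (_ + _); rewrite mulrA; congr (_ * _).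
have -> : (i < n - i)%N = (2 * i < n)%N by lia.
by case: ifP => _; rewrite mulrC // mulrN.
Qed.

(** A doubled pair gives [2 / sqrt 2 = sqrt 2] and a self-paired row gives [1 = sqrt 2 / sqrt 2];
    the factor [halved] records both cases at once. *)
Lemma sum_butterfly_sym e n f i : (i < n)%N -> e ^+ 2 = 1 ->
    self_paired n i \/ f (n - i)%N = pair_sign e n i * f i ->
  \sum_(l < n) butterfly e n i l * f l = sqrt2 * halved n i * f i.
Proof.
move=> lt_in e2 fP; rewrite sum_butterfly // /halved.
case: ifPn => [_|/negbTE npair_i].
  by rewrite mulfV ?mul1r ?sqrt2_neq0.
case: fP => [|->]; first by rewrite npair_i.
have -> : pair_sign e n i * (pair_sign e n i * f i) = f i.
  by rewrite mulrA -expr2 /pair_sign; case: ifP => _; rewrite ?sqrrN e2 mul1r.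
by rewrite sqrt2V; field.
Qed.

(** The two terms of a pair cancel. A self-paired row has nothing to cancel against, so there [f i]
    itself must vanish. *)
Lemma sum_butterfly_anti e n f i : (i < n)%N -> e ^+ 2 = 1 ->
    (self_paired n i -> f i = 0) -> f (n - i)%N = - (pair_sign e n i * f i) ->
  \sum_(l < n) butterfly e n i l * f l = 0.
Proof.
move=> lt_in e2 f0 fN; rewrite sum_butterfly //.
case: ifPn => [/f0 //|_]; rewrite fN mulrN mulrA -expr2 /pair_sign.
by case: ifP => _; rewrite ?sqrrN e2 mul1r subrr mulr0.
Qed.

End Butterfly.

(** * Closed forms for the entries of [U], [Ut] and of the two products *)

Section Entries.
Variable R : realType.
Implicit Types n i j l m : nat.

Local Notation sqrt2 := (Num.sqrt 2 : R).
Local Notation c n := ((Num.sqrt n%:R)^-1 : R).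

Lemma dft_angle_reflect n i j : (i <= n)%N -> (0 < n)%N ->
  dft_angle R n (n - i) j = (2 * j)%:R * pi - dft_angle R n i j.
Proof.
move=> le_in n_gt0; rewrite /dft_angle !natrM natrB //; field.
by rewrite pnatr_eq0 -lt0n.
Qed.

(** The odd multiple of [pi], against the even one for [dft_angle], reverses the parity of cosine
    and sine; this is why [Ut] goes with [Q^T]. *)
Lemma shifted_angle_reflect n i j : (i <= n)%N -> (0 < n)%N ->
  shifted_angle R n (n - i) j = (2 * j).+1%:R * pi - shifted_angle R n i j.
Proof.
move=> le_in n_gt0; rewrite /shifted_angle !natrM natrB //; field.
by rewrite pnatr_eq0 -lt0n.
Qed.

Lemma signr_double k : (-1) ^+ (2 * k) = 1 :> R.
Proof. by rewrite exprM sqrrN !expr1n. Qed.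

Lemma cos_dft_reflect n i j : (i <= n)%N -> (0 < n)%N ->
  cos (dft_angle R n (n - i) j) = cos (dft_angle R n i j).
Proof.
by move=> *; rewrite dft_angle_reflect // cos_npiB signr_double mul1r.
Qed.

Lemma sin_dft_reflect n i j : (i <= n)%N -> (0 < n)%N ->
  sin (dft_angle R n (n - i) j) = - sin (dft_angle R n i j).
Proof.
by move=> *; rewrite dft_angle_reflect // sin_npiB signr_double mul1r.
Qed.

Lemma cos_shifted_reflect n i j : (i <= n)%N -> (0 < n)%N ->
  cos (shifted_angle R n (n - i) j) = - cos (shifted_angle R n i j).
Proof.
move=> *; rewrite shifted_angle_reflect // cos_npiB exprS signr_double.
by rewrite mulr1 mulN1r.
Qed.

Lemma sin_shifted_reflect n i j : (i <= n)%N -> (0 < n)%N ->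
  sin (shifted_angle R n (n - i) j) = sin (shifted_angle R n i j).
Proof.
move=> *; rewrite shifted_angle_reflect // sin_npiB exprS signr_double mulr1.
by rewrite mulN1r opprK.
Qed.

(** The weight [iota] of the type VI transform: for [n = 2 m + 1], the middle column [ctilde m] is
    the only one without the factor [sqrt2]. *)
Definition halved_last n j : R := if ((2 * j).+1 == n)%N then sqrt2^-1 else 1.

(** One formula for both parities of [n]. The factor [halved] cancels [sqrt2] on the unscaled cosine
    columns; the minus sign comes from the negative exponent in [Fmx]; the sine columns run
    backwards, whence [n - j]. *)
Definition u_entry n i j : R :=
  if (2 * j <= n)%N then sqrt2 * halved R n j * (c n * cos (dft_angle R n i j))
  else sqrt2 * - (c n * sin (dft_angle R n i (n - j))).

(** For [n = 2 m] column [m] is already a sine, so the test is strict; the sines run down to index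
    [0] rather than [1], whence [n - j.+1]. *)
Definition ut_entry n i j : R :=
  if (2 * j < n)%N then
    sqrt2 * halved_last n j * (c n * cos (shifted_angle R n i j))
  else sqrt2 * (c n * sin (shifted_angle R n i (n - j.+1))).

(** One [sqrt2] from the butterfly and one from the columns make the [2]; the row weight comes from
    [Q], the column weight from [U]. Conjugation by [J] shows as [n - i] and [n - j]. *)
Definition qu_entry n i j : R :=
  if (2 * i <= n)%N then
    if (2 * j <= n)%N then
      2 * c n * (halved R n i * halved R n j * cos (dft_angle R n i j))
    else 0
  else
    if (2 * j <= n)%N then 0 else 2 * c n * sin (dft_angle R n (n - i) (n - j)).

Definition qtut_entry n i j : R :=
  if (2 * i < n)%N then
    if (2 * j < n)%N then
      2 * c n * (halved R n i * halved_last n j * cos (shifted_angle R n i j))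
    else 0
  else
    if (2 * j < n)%N then 0
    else 2 * c n * (halved R n i * sin (shifted_angle R n (n - i) (n - j.+1))).

Let half_eq0 (x : R) : x = - x -> x = 0.
Proof. by move=> h; lra. Qed.

Lemma butterfly_u n i j : (i < n)%N ->
  \sum_(l < n) butterfly 1 n i l * u_entry n l j = qu_entry n i j.
Proof.
move=> lt_in; have n_gt0 : (0 < n)%N by lia.
have le_in := ltnW lt_in.
rewrite /qu_entry /u_entry; case: (leqP (2 * j)) => hj.
  pose f l := sqrt2 * halved R n j * (c n * cos (dft_angle R n l j)).
  have fP : f (n - i)%N = f i by rewrite /f cos_dft_reflect.
  case: (leqP (2 * i)) => hi.
    rewrite (@sum_butterfly_sym _ _ _ f) ?expr1n //; last first.
      rewrite fP /pair_sign; case: ltngtP hi => [_|//|hi] _.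
        by right; rewrite mul1r.
      by left; rewrite /self_paired hi eqxx orbT.
    by rewrite /f -[X in _ = X * _ * _]sqrt2_sqr; ring.
  rewrite (@sum_butterfly_anti _ _ _ f) ?expr1n // => [|].
    by rewrite /self_paired; lia.
  by rewrite fP /pair_sign ifF ?mulN1r ?opprK //; lia.
pose f l := sqrt2 * - (c n * sin (dft_angle R n l (n - j))).
have fP : f (n - i)%N = - f i by rewrite /f sin_dft_reflect // !mulrN.
case: (leqP (2 * i)) => hi.
  have f0 : self_paired n i -> f i = 0.
    case/orP => [/eqP ->|/eqP ein].
      by rewrite /f /dft_angle muln0 !mul0r sin0 mulr0 oppr0 mulr0.
    (* In the middle row [n - i = i], so oddness reads [f i = - f i]. *)
    apply: half_eq0; rewrite -[RHS]fP; congr f; lia.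
  rewrite (@sum_butterfly_anti _ _ _ f) ?expr1n //.
  rewrite fP /pair_sign; case: ltngtP hi => [_|//|hi] _; rewrite ?mul1r //.
  (* In the middle row [pair_sign] is [-1], and the required relation holds only because
     [f i = 0]. *)
  by rewrite f0 ?mulr0 // /self_paired hi eqxx orbT.
rewrite (@sum_butterfly_sym _ _ _ f) ?expr1n //; last first.
  by right; rewrite fP /pair_sign ifF ?mulN1r //; lia.
rewrite /halved ifF; last by rewrite /self_paired; lia.
(* Reflecting the row to [n - i] flips the sine and absorbs the minus sign of [u_entry]. *)
rewrite /f sin_dft_reflect // -[X in _ = X * _ * _]sqrt2_sqr; ring.
Qed.

Lemma butterfly_ut n i j : (i < n)%N ->
  \sum_(l < n) butterfly (-1) n i l * ut_entry n l j = qtut_entry n i j.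
Proof.
move=> lt_in; have n_gt0 : (0 < n)%N by lia.
have le_in := ltnW lt_in.
have sqrN1 : (-1) ^+ 2 = 1 :> R by rewrite sqrrN expr1n.
rewrite /qtut_entry /ut_entry; case: (ltnP (2 * j)) => hj.
  pose f l := sqrt2 * halved_last n j * (c n * cos (shifted_angle R n l j)).
  have fP : f (n - i)%N = - f i by rewrite /f cos_shifted_reflect // !mulrN.
  case: (ltnP (2 * i)) => hi.
    rewrite (@sum_butterfly_sym _ _ _ f) //; last first.
      by right; rewrite fP /pair_sign hi mulN1r.
    by rewrite /f -[X in _ = X * _ * _]sqrt2_sqr; ring.
  rewrite (@sum_butterfly_anti _ _ _ f) // => [pair_i|].
    (* In the lower half, self-pairing means [2 * i = n], where again [f i = - f i]. *)
    apply: half_eq0; rewrite -fP; congr f.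
    by move: pair_i; rewrite /self_paired; lia.
  by rewrite fP /pair_sign ltnNge hi opprK mul1r.
pose f l := sqrt2 * (c n * sin (shifted_angle R n l (n - j.+1))).
have fP : f (n - i)%N = f i by rewrite /f sin_shifted_reflect.
case: (ltnP (2 * i)) => hi.
  rewrite (@sum_butterfly_anti _ _ _ f) // => [pair_i|].
    have -> : i = 0%N by move: pair_i; rewrite /self_paired; lia.
    by rewrite /f /shifted_angle mul0n !mul0r sin0 !mulr0.
  by rewrite fP /pair_sign hi mulN1r opprK.
rewrite (@sum_butterfly_sym _ _ _ f) //; last first.
  by right; rewrite fP /pair_sign ltnNge hi opprK mul1r.
rewrite /f sin_shifted_reflect // -[X in _ = X * _ * _]sqrt2_sqr; ring.
Qed.

End Entries.

Local Ltac decide_ifs :=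
  repeat first [rewrite ifT; last by lia | rewrite ifF; last by lia].

(** * Entries of the matrices given by blocks or by lists of columns *)

Section Matrices.
Variable R : realType.
Implicit Types m : nat.

Local Notation sqrt2 := (Num.sqrt 2 : R).

Lemma antidiag_conjE k (A : 'M[R]_k) (i j : 'I_k) :
  (antidiag_mx R k *m A *m antidiag_mx R k) i j = A (rev_ord i) (rev_ord j).
Proof.
rewrite mxE (bigD1 (rev_ord j)) //= big1 => [|l neq_lj].
  rewrite mxE (bigD1 (rev_ord i)) //= big1 => [|l neq_li].
    by rewrite !mxE rev_ordK !eqxx mul1r mulr1 !addr0.
  by rewrite mxE (negbTE neq_li) mul0r.
rewrite [X in _ * X]mxE (_ : (j == rev_ord l) = false) ?mulr0 //.
by apply/negbTE; apply: contra neq_lj => /eqP ->; rewrite rev_ordK.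
Qed.

Lemma Q_evenE m (m_gt0 : (0 < m)%N) (i j : 'I_(2 * m)) :
  Q_even R m_gt0 i j = butterfly 1 (2 * m) i j.
Proof.
rewrite mxE castmxE mxE /butterfly /self_paired.
(* Each index is located in the outer two-by-two grouping, then inside its group; impossible
   combinations of positions are left to [lia]. *)
case: splitP => i1 /= ->; rewrite mxE; case: splitP => j1 /= ->; rewrite mxE;
  case: splitP => i2 /= ->; rewrite mxE; case: splitP => j2 /= ->;
  rewrite ?ord1 ?mxE -?val_eqE /=; have := ltn_ord i2; have := ltn_ord j2;
  do ?[case: (_ =P _) => ?] => *;
  decide_ifs;
  rewrite ?(oppr0, mulr0, mulr1, mul1r, mulrN, mulVf) ?sqrt2_neq0 //;
  by exfalso; lia.
Qed.

Lemma Q_oddE m (i j : 'I_(2 * m).+1) :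
  Q_odd R m i j = butterfly 1 (2 * m).+1 i j.
Proof.
rewrite mxE castmxE mxE /butterfly /self_paired.
case: splitP => i1 /= ->; rewrite mxE; case: splitP => j1 /= ->;
  rewrite ?mxE;
  try (case: splitP => i2 /= ->; rewrite mxE; case: splitP => j2 /= ->;
       have := ltn_ord i2; have := ltn_ord j2);
  have := ltn_ord i1; have := ltn_ord j1;
  rewrite ?ord1 ?mxE -?val_eqE /=;
  do ?[case: (_ =P _) => ?] => *;
  decide_ifs;
  rewrite ?(oppr0, mulr0, mulr1, mul1r, mulrN, mulVf) ?sqrt2_neq0 //;
  by exfalso; lia.
Qed.

Lemma nth_scaled_iota n (v : nat -> 'cV[R]_n) a b l (i : 'I_n) : (l < b)%N ->
  (nth 0 [seq sqrt2 *: v k | k <- iota a b] l) i 0 = sqrt2 * v (a + l)%N i 0.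
Proof.
by move=> lt_lb; rewrite (nth_map 0%N) ?size_iota // nth_iota // mxE.
Qed.

Lemma nth_rev_scaled_iota n (v : nat -> 'cV[R]_n) a b l (i : 'I_n) :
    (l < b)%N ->
  (nth 0 (rev [seq sqrt2 *: v k | k <- iota a b]) l) i 0
    = sqrt2 * v (a + (b - l.+1))%N i 0.
Proof.
move=> lt_lb; rewrite nth_rev size_map size_iota // nth_scaled_iota //; lia.
Qed.

Lemma U_evenE m (i j : 'I_(2 * m)) : U_even R m i j = u_entry R (2 * m) i j.
Proof.
have lt_jn := ltn_ord j; have m_gt0 : (0 < m)%N by lia.
(* The single columns become one-element lists, so that each range of column indices is one piece of
   a concatenation. *)
rewrite mxE /u_entry /U_even_cols -cat1s -[chat _ _ m :: _]cat1s !nth_cat /=.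
rewrite !size_map !size_iota /halved /self_paired.
case: ifP => h1.
  have -> : (j : nat) = 0%N by lia.
  by decide_ifs; rewrite chatE ?mulfV ?sqrt2_neq0 ?mul1r //; lia.
case: ifP => h2.
  rewrite nth_scaled_iota // chatE; last by lia.
  by decide_ifs; rewrite mulr1 subnKC //; lia.
case: ifP => h3.
  have -> : (j : nat) = m by lia.
  have -> : (m - 1 - m.-1 = 0)%N by lia.
  by decide_ifs; rewrite chatE ?mulfV ?sqrt2_neq0 ?mul1r //; lia.
rewrite nth_rev_scaled_iota ?shatE; try lia.
decide_ifs; do 5!congr (_ _); lia.
Qed.

Lemma U_oddE m (i j : 'I_(2 * m).+1) : U_odd R m i j = u_entry R (2 * m).+1 i j.
Proof.
have lt_jn := ltn_ord j.
rewrite mxE /u_entry /U_odd_cols -cat1s !nth_cat /=.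
rewrite !size_map !size_iota /halved /self_paired.
case: ifP => h1.
  have -> : (j : nat) = 0%N by lia.
  by decide_ifs; rewrite chatE ?mulfV ?sqrt2_neq0 ?mul1r //; lia.
case: ifP => h2.
  rewrite nth_scaled_iota // chatE; last by lia.
  by decide_ifs; rewrite mulr1 subnKC //; lia.
rewrite nth_rev_scaled_iota ?shatE; try lia.
decide_ifs; do 5!congr (_ _); lia.
Qed.

Lemma Ut_evenE m (i j : 'I_(2 * m)) : Ut_even R m i j = ut_entry R (2 * m) i j.
Proof.
have lt_jn := ltn_ord j.
rewrite mxE /ut_entry /Ut_even_cols nth_cat size_map size_iota /halved_last.
case: ifP => h1.
  rewrite nth_scaled_iota // ctildeE; last by lia.
  by decide_ifs; rewrite mulr1.
rewrite nth_rev_scaled_iota ?stildeE; try lia.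
decide_ifs; do 5!congr (_ _); lia.
Qed.

Lemma Ut_oddE m (i j : 'I_(2 * m).+1) :
  Ut_odd R m i j = ut_entry R (2 * m).+1 i j.
Proof.
have lt_jn := ltn_ord j.
rewrite mxE /ut_entry /Ut_odd_cols -[ctilde _ _ m :: _]cat1s !nth_cat.
rewrite size_map size_iota /halved_last /=.
case: ifP => h1.
  rewrite nth_scaled_iota // ctildeE; last by lia.
  by decide_ifs; rewrite mulr1.
case: ifP => h2.
  have -> : (j : nat) = m by lia.
  rewrite subnn /=.
  by decide_ifs; rewrite ctildeE ?mulfV ?sqrt2_neq0 ?mul1r //; lia.
rewrite nth_rev_scaled_iota ?stildeE; try lia.
decide_ifs; do 5!congr (_ _); lia.
Qed.

End Matrices.

(** * Entries of the block-diagonal cosine and sine transforms *)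

Section Transforms.
Variable R : realType.
Implicit Types m : nat.

Lemma even_scale m : (0 < m)%N ->
  Num.sqrt (2 / m%:R) = 2 * (Num.sqrt (2 * m)%:R)^-1 :> R.
Proof.
move=> m_gt0; have m_neq0 : m%:R != 0 :> R by rewrite pnatr_eq0 -lt0n.
have -> : 2 / m%:R = 2 ^+ 2 * (2 * m)%:R^-1 :> R by rewrite natrM; field.
by rewrite sqrtrM ?sqr_ge0 // sqrtr_sqr sqrtrV ?ler0n // ger0_norm.
Qed.

(** With [N = m + 1] the denominator [2 N - 1] is [n]. The same identity turns the sine factor
    [2 (k + 1) - 1] into [2 k + 1]. *)
Lemma odd_denom m : 2 * m.+1%:R - 1 = (2 * m).+1%:R :> R.
Proof. ring. Qed.

Lemma tau_even m l : tau R m l = halved R (2 * m) l.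
Proof. by rewrite /tau /halved /self_paired eqn_pmul2l. Qed.

(** For [l <= m] the test [l == m.+1] fails, and [2 * l] is never odd, so both weights single out
    [l = 0]. *)
Lemma tau_odd m l : (l <= m)%N -> tau R m.+1 l = halved R (2 * m).+1 l.
Proof.
move=> le_lm; rewrite /tau /halved /self_paired.
by have -> : (l == m.+1) = (2 * l == (2 * m).+1)%N by lia.
Qed.

Lemma iot_odd m k : iot R m.+1 k = halved_last R (2 * m).+1 k.
Proof. by rewrite /iot /halved_last eqSS eqn_pmul2l. Qed.

Lemma DCT1_DST1E m (m_gt0 : (0 < m)%N) (i j : 'I_(2 * m)) :
  castmx (dim_QU_even m_gt0, dim_QU_even m_gt0)
    (block_mx (DCT1 R m) 0
       0 (antidiag_mx R m.-1 *m DST1 R m *m antidiag_mx R m.-1)) i j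
  = qu_entry R (2 * m) i j.
Proof.
have m_neq0 : m%:R != 0 :> R by rewrite pnatr_eq0 -lt0n.
rewrite castmxE mxE /qu_entry.
case: splitP => i1 /= ->; rewrite mxE; case: splitP => j1 /= ->;
  have := ltn_ord i1; have := ltn_ord j1 => lt_j1 lt_i1;
  decide_ifs; rewrite ?antidiag_conjE !mxE // even_scale //; congr (_ * _).
  rewrite !tau_even; congr (_ * cos _).
  by rewrite /dft_angle; field.
congr (sin _); rewrite /dft_angle /=.
(* Reversal by [rev_ord] followed by the shift to sine indices starting at [1] is the reflection
   through [n]. *)
have -> : (2 * m - (m.+1 + i1) = (m.-1 - i1.+1).+1)%N by lia.
have -> : (2 * m - (m.+1 + j1) = (m.-1 - j1.+1).+1)%N by lia.
by rewrite !natrM; field.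
Qed.

Lemma DCT2_DST2E m (i j : 'I_(2 * m)) :
  castmx (dim_QtUt_even m, dim_QtUt_even m)
    (block_mx (DCT2 R m) 0
       0 (antidiag_mx R m *m DST2 R m *m antidiag_mx R m)) i j
  = qtut_entry R (2 * m) i j.
Proof.
have m_gt0 : (0 < m)%N by have := ltn_ord i; lia.
have m_neq0 : m%:R != 0 :> R by rewrite pnatr_eq0 -lt0n.
rewrite castmxE mxE /qtut_entry.
case: splitP => i1 /= ->; rewrite mxE; case: splitP => j1 /= ->;
  have := ltn_ord i1; have := ltn_ord j1 => lt_j1 lt_i1;
  decide_ifs; rewrite ?antidiag_conjE !mxE // even_scale //; congr (_ * _).
  rewrite tau_even /halved_last ifF ?mulr1; last by lia.
  by congr (_ * cos _); rewrite /shifted_angle; field.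
rewrite odd_denom /tau /halved /self_paired /shifted_angle /=.
(* The weight of the last sine row is carried by reversal to [i1 = 0], which is the self-paired
   middle row [m] of the product. *)
have <- : ((m - i1.+1).+1 == m) = ((m + i1 == 0) || (2 * (m + i1) == 2 * m))%N.
  by lia.
congr (_ * sin _).
have -> : (2 * m - (m + i1) = (m - i1.+1).+1)%N by lia.
have -> : (2 * m - (m + j1).+1 = m - j1.+1)%N by lia.
by rewrite !natrM; field.
Qed.

Lemma DCT5_DST5E m (i j : 'I_(2 * m).+1) :
  castmx (dim_odd m, dim_odd m)
    (block_mx (DCT5 R m.+1) 0
       0 (antidiag_mx R m *m DST5 R m.+1 *m antidiag_mx R m)) i j
  = qu_entry R (2 * m).+1 i j.
Proof.
rewrite castmxE mxE /qu_entry.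
case: splitP => i1 /= ->; rewrite mxE; case: splitP => j1 /= ->;
  have := ltn_ord i1; have := ltn_ord j1 => lt_j1 lt_i1;
  decide_ifs; rewrite ?(@antidiag_conjE _ m) !mxE // odd_denom.
  by rewrite !tau_odd // /dft_angle -mulnA [(2 * _)%:R]natrM.
congr (_ * sin _); rewrite /dft_angle /=.
have -> : ((2 * m).+1 - (m.+1 + i1) = (m - i1.+1).+1)%N by lia.
have -> : ((2 * m).+1 - (m.+1 + j1) = (m - j1.+1).+1)%N by lia.
by rewrite -mulnA [(2 * _)%:R]natrM.
Qed.

Lemma DCT6_DST6E m (i j : 'I_(2 * m).+1) :
  castmx (dim_odd m, dim_odd m)
    (block_mx (DCT6 R m.+1) 0
       0 (antidiag_mx R m *m DST6 R m.+1 *m antidiag_mx R m)) i j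
  = qtut_entry R (2 * m).+1 i j.
Proof.
rewrite castmxE mxE /qtut_entry.
case: splitP => i1 /= ->; rewrite mxE; case: splitP => j1 /= ->;
  have := ltn_ord i1; have := ltn_ord j1 => lt_j1 lt_i1;
  decide_ifs; rewrite ?(@antidiag_conjE _ m) !mxE // !odd_denom.
  by rewrite tau_odd // iot_odd /shifted_angle natrM -[(2 * j1).+1%:R]natr1 natrM.
(* For odd [n] no row below the cosine block is self-paired, so all weights there are [1]. *)
rewrite /halved ifF; last by rewrite /self_paired; lia.
rewrite mul1r /shifted_angle natrM /=.
congr (_ * sin (_%:R * _.+1%:R * _ / _)); lia.
Qed.

End Transforms.

Theorem theorem3p1 (R : realType) (m : nat) :
  (forall m_gt0 : (0 < m)%N,
     Q_even R m_gt0 *m U_even R m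
       = castmx (dim_QU_even m_gt0, dim_QU_even m_gt0)
           (block_mx (DCT1 R m) 0
                     0 (antidiag_mx R m.-1 *m DST1 R m *m antidiag_mx R m.-1))
     /\ (Q_even R m_gt0)^T *m Ut_even R m
       = castmx (dim_QtUt_even m, dim_QtUt_even m)
           (block_mx (DCT2 R m) 0
                     0 (antidiag_mx R m *m DST2 R m *m antidiag_mx R m)))
  /\
  (Q_odd R m *m U_odd R m
     = castmx (dim_odd m, dim_odd m)
         (block_mx (DCT5 R m.+1) 0
                   0 (antidiag_mx R m *m DST5 R m.+1 *m antidiag_mx R m))
   /\ (Q_odd R m)^T *m Ut_odd R m
     = castmx (dim_odd m, dim_odd m)
         (block_mx (DCT6 R m.+1) 0
                   0 (antidiag_mx R m *m DST6 R m.+1 *m antidiag_mx R m))).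
Proof.
split=> [m_gt0|]; split; apply/matrixP => i j.
(* The right-hand side passes through its closed form to a butterfly sum, which matches the matrix
   product term by term. *)
- rewrite DCT1_DST1E -butterfly_u // mxE.
  by apply: eq_bigr => l _; rewrite Q_evenE U_evenE.
- rewrite DCT2_DST2E -butterfly_ut // mxE.
  by apply: eq_bigr => l _; rewrite mxE Q_evenE butterflyC Ut_evenE.
- rewrite DCT5_DST5E -butterfly_u // mxE.
  by apply: eq_bigr => l _; rewrite Q_oddE U_oddE.
- rewrite DCT6_DST6E -butterfly_ut // mxE.
  by apply: eq_bigr => l _; rewrite mxE Q_oddE butterflyC Ut_oddE.
Qed.
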